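(* If a game has $K=118$, then its critical-move colour sequence has at least four blocks and $S\ge 3$.
   Context: Game. Legal moves are those of standard chess (including the initial two-rank pawn advance, en passant, compulsory promotion, and castling, which counts as one move). One ply is one move by one player; White plays the odd-numbered plies. A game is a sequence of legal moves from the standard initial position, continued until the first mandatory termination condition of the FIDE Laws effective from 1 January 2023 applies; $L$ is its number of plies. The mandatory conditions are: (1) checkmate, stalemate, or a dead position (one from which neither player can checkmate by any possible sequence of legal moves); (2) fivefold repetition: the same position (same player to move, same kinds and colours of pieces on the same squares, same possible moves of all pieces of both players, so en passant availability and castling rights matter) has appeared at least five times; (3) the seventy-five-move rule: 150 consecutive plies without a pawn move or a capture (if the final ply delivers checkmate, checkmate takes precedence). Time forfeiture, resignation, draws by agreement and claimable draws are disregarded. Segments. A critical move is a pawn move (a move of a piece while it is still a pawn, including promotion moves) or a capture; every other move (including castling) is noncritical. Let $t_1<\dots<t_m$ be the plies on which critical moves occur. Set $T=1$ if at least one noncritical ply follows the last critical move, or if the game contains no critical move, and $T=0$ otherwise. Put $e_0=0$, $e_i=t_i$ for $1\le i\le m$ and, when $T=1$, $e_{m+1}=L$. The number of segments is $K=m+T$, segment $i$ being the set of plies $\{e_{i-1}+1,\dots,e_i\}$ ($1\le i\le K$). Switch count. For $i\ge1$, $\operatorname{col}(e_i)$ is the colour of the player who moves on ply $e_i$ (White if $e_i$ is odd, Black if even); the virtual endpoint $e_0=0$ is assigned the colour Black. The switch count is $S=\#\{i\in\{1,\dots,K\}:\operatorname{col}(e_i)\ne\operatorname{col}(e_{i-1})\}$.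 Blocks. The critical-move colour sequence is $(\operatorname{col}(t_1),\dots,\operatorname{col}(t_m))$. The blocks of a nonempty finite sequence of colours are its maximal constant runs. (When $K=118$ one has $m\ge117$, so this sequence is nonempty.) *)

(* Defs.v *)
From HB Require Import structures.
From mathcomp Require Import all_boot.

Set Implicit Arguments.
Unset Strict Implicit.
Unset Printing Implicit Defensive.

Inductive color := White | Black.
Inductive kind := Pawn | Knight | Bishop | Rook | Queen | King.
Inductive side := KingSide | QueenSide.

Definition bool_of_color c := if c is White then true else false.
Definition color_of_bool b := if b then White else Black.
Lemma bool_of_colorK : cancel bool_of_color color_of_bool.
Proof. by case. Qed.
HB.instance Definition _ := Finite.copy color (can_type bool_of_colorK).

Definition bool_of_side sd := if sd is KingSide then true else false.
Definition side_of_bool b := if b then KingSide else QueenSide.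
Lemma bool_of_sideK : cancel bool_of_side side_of_bool.
Proof. by case. Qed.
HB.instance Definition _ := Finite.copy side (can_type bool_of_sideK).

Definition ord_of_kind k : 'I_6 :=
  inord match k with
        | Pawn => 0 | Knight => 1 | Bishop => 2
        | Rook => 3 | Queen => 4 | King => 5
        end.
Definition kind_of_ord (i : 'I_6) :=
  nth King [:: Pawn; Knight; Bishop; Rook; Queen; King] i.
Lemma ord_of_kindK : cancel ord_of_kind kind_of_ord.
Proof. by case; rewrite /kind_of_ord /ord_of_kind inordK. Qed.
HB.instance Definition _ := Finite.copy kind (can_type ord_of_kindK).

Definition opponent c := if c is White then Black else White.

(* A square is a pair (file, rank), both numbered from 0: a1 is (0, 0) and    *)
(* h8 is (7, 7).                                                              *)
Definition square := ('I_8 * 'I_8)%type.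
Definition sq (f r : nat) : square := (inord f, inord r).

Definition dist (m n : nat) := (m - n) + (n - m).
Definition fdist (a t : square) := dist a.1 t.1.
Definition rdist (a t : square) := dist a.2 t.2.

(* Rank as seen by the player c: his pieces start on 0, his pawns on 1, and   *)
(* pawns promote on 7.                                                        *)
Definition rel_rank c (s : square) : nat := if c is White then s.2 else 7 - s.2.

Definition board := {ffun square -> option (color * kind)}.

Definition orthogonal (a t : square) :=
  (a != t) && ((fdist a t == 0) || (rdist a t == 0)).
Definition diagonal (a t : square) := (a != t) && (fdist a t == rdist a t).

(* s lies strictly between a and t, which are meant to be on a common rank,   *)
(* file or diagonal: s is in the bounding box of a and t and, when this box   *)
(* is not reduced to a segment, also on the diagonal through a.               *)
Definition between (a t s : square) :=
  [&& s != a, s != t,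
      fdist a s + fdist s t == fdist a t,
      rdist a s + rdist s t == rdist a t
    & orthogonal a t || diagonal a s].

Definition clear (b : board) (a t : square) :=
  [forall s, between a t s ==> (b s == None)].

(* The piece (c, k), standing on a, attacks t. *)
Definition piece_attacks (b : board) c k (a t : square) :=
  match k with
  | Pawn => (fdist a t == 1) && (rel_rank c t == (rel_rank c a).+1)
  | Knight => [|| (fdist a t == 1) && (rdist a t == 2)
                | (fdist a t == 2) && (rdist a t == 1)]
  | Bishop => diagonal a t && clear b a t
  | Rook => orthogonal a t && clear b a t
  | Queen => (orthogonal a t || diagonal a t) && clear b a t
  | King => [&& a != t, fdist a t <= 1 & rdist a t <= 1]
  end.

Definition attacked (b : board) c (t : square) :=
  [exists a, if b a is Some (c', k) then (c' == c) && piece_attacks b c k a t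
             else false].

Definition in_check (b : board) c :=
  [exists s, (b s == Some (c, King)) && attacked b (opponent c) s].

(* en_passant is the square just crossed by a pawn which has advanced two     *)
(* squares on the last ply, whether or not some pawn can capture it.          *)
Record position := Position {
  pieces : board;
  turn : color;
  castling_rights : {set color * side};
  en_passant : option square }.

Definition initial_board : board :=
  [ffun s : square =>
     let officer :=
       nth King [:: Rook; Knight; Bishop; Queen; King; Bishop; Knight; Rook]
           s.1 in
     match nat_of_ord s.2 with
     | 0 => Some (White, officer)
     | 1 => Some (White, Pawn)
     | 6 => Some (Black, Pawn)
     | 7 => Some (Black, officer)
     | _ => None
     end].

Definition initial_position := Position initial_board White setT None.

(* Every move other than castling is Step a t pr, from a to t, with pr the    *)
(* kind chosen in case of a promotion.                                        *)
Inductive move := Step (a t : square) (pr : option kind) | Castle (sd : side).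

Definition sum_of_move m : square * square * option kind + side :=
  match m with Step a t pr => inl (a, t, pr) | Castle sd => inr sd end.
Definition move_of_sum (x : square * square * option kind + side) :=
  match x with inl (a, t, pr) => Step a t pr | inr sd => Castle sd end.
Lemma sum_of_moveK : cancel sum_of_move move_of_sum.
Proof. by case. Qed.
HB.instance Definition _ := Finite.copy move (can_type sum_of_moveK).

Definition home_rank c := if c is White then 0 else 7.
Definition king_home c := sq 4 (home_rank c).
Definition rook_home c sd :=
  sq (if sd is KingSide then 7 else 0) (home_rank c).
Definition king_castled c sd :=
  sq (if sd is KingSide then 6 else 2) (home_rank c).
Definition rook_castled c sd :=
  sq (if sd is KingSide then 5 else 3) (home_rank c).

Definition is_pawn (x : option (color * kind)) :=
  if x is Some (_, Pawn) then true else false.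

Definition capturable c (x : option (color * kind)) :=
  if x is Some (c', k) then (c' == opponent c) && (k != King) else false.

Definition pawn_can_reach (p : position) (a t : square) :=
  let b := pieces p in
  let c := turn p in
  [|| [&& fdist a t == 0, rel_rank c t == (rel_rank c a).+1 & b t == None],
      [&& fdist a t == 0, rel_rank c a == 1, rel_rank c t == 3,
          clear b a t & b t == None]
    | piece_attacks b c Pawn a t &&
      (capturable c (b t) || (b t == None) && (en_passant p == Some t))].

Definition promotion_ok c k (t : square) (pr : option kind) :=
  if (k == Pawn) && (rel_rank c t == 7)
  then pr \in [:: Some Knight; Some Bishop; Some Rook; Some Queen]
  else pr == None.

Definition step_ok (p : position) (a t : square) (pr : option kind) :=
  let b := pieces p in
  let c := turn p in
  if b a is Some (c', k) then
    [&& c' == c, promotion_ok c k t pr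
      & if k == Pawn then pawn_can_reach p a t
        else piece_attacks b c k a t && ((b t == None) || capturable c (b t))]
  else false.

(* The king crosses rook_castled c sd and arrives on king_castled c sd. *)
Definition castle_ok (p : position) sd :=
  let b := pieces p in
  let c := turn p in
  [&& (c, sd) \in castling_rights p,
      b (king_home c) == Some (c, King),
      b (rook_home c sd) == Some (c, Rook),
      clear b (king_home c) (rook_home c sd)
    & all (fun s => ~~ attacked b (opponent c) s)
          [:: king_home c; rook_castled c sd; king_castled c sd]].

(* A diagonal pawn move to an empty square is an en passant capture; the pawn *)
(* captured stands on the file of t and on the rank of a.                     *)
Definition step_board (p : position) (a t : square) (pr : option kind)
    : board :=
  let b := pieces p in
  [ffun s =>
     if s == t then (if pr is Some k then Some (turn p, k) else b a)
     else if s == a then None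
     else if [&& is_pawn (b a), b t == None & s == (t.1, a.2)] then None
     else b s].

Definition castle_board (p : position) sd : board :=
  let c := turn p in
  [ffun s =>
     if s == king_castled c sd then Some (c, King)
     else if s == rook_castled c sd then Some (c, Rook)
     else if (s == king_home c) || (s == rook_home c sd) then None
     else pieces p s].

Definition play (p : position) (m : move) : position :=
  match m with
  | Step a t pr =>
      Position (step_board p a t pr) (opponent (turn p))
        [set x in castling_rights p |
           [disjoint [:: king_home x.1; rook_home x.1 x.2] & [:: a; t]]]
        (if is_pawn (pieces p a) && (rdist a t == 2)
         then Some (a.1, inord ((a.2 + t.2)./2)) else None)
  | Castle sd =>
      Position (castle_board p sd) (opponent (turn p))
        [set x in castling_rights p | x.1 != turn p] None
  end.

Definition legal (p : position) (m : move) :=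
  match m with Step a t pr => step_ok p a t pr | Castle sd => castle_ok p sd end
  && ~~ in_check (pieces (play p m)) (turn p).

Fixpoint legal_sequence (p : position) (ms : seq move) :=
  if ms is m :: ms' then legal p m && legal_sequence (play p m) ms' else true.

Definition no_legal_move (p : position) := [forall m, ~~ legal p m].
Definition checkmate (p : position) :=
  in_check (pieces p) (turn p) && no_legal_move p.
Definition stalemate (p : position) :=
  ~~ in_check (pieces p) (turn p) && no_legal_move p.

Definition dead (p : position) : Prop :=
  ~ exists ms, legal_sequence p ms /\ checkmate (foldl play p ms).

(* En passant availability is compared through the legal moves of the player  *)
(* to move, so that an en passant square on which no capture is legal is      *)
(* disregarded. The moves of the other player depend on the board and on the  *)
(* castling rights only.                                                      *)
Definition same_position (p q : position) :=
  [&& turn p == turn q, pieces p == pieces q,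
      castling_rights p == castling_rights q
    & [forall m, legal p m == legal q m]].

(* In the sequel ms is the list of moves played from the initial position,    *)
(* and its length is the number of plies, numbered from 1.                    *)
Definition position_after (ms : seq move) i :=
  foldl play initial_position (take i ms).

Definition history (ms : seq move) :=
  [seq position_after ms i | i <- iota 0 (size ms).+1].

Definition critical (p : position) (m : move) :=
  if m is Step a t _ then is_pawn (pieces p a) || (pieces p t != None)
  else false.

Definition critical_ply (ms : seq move) i :=
  if ohead (drop i.-1 ms) is Some m then critical (position_after ms i.-1) m
  else false.

Definition fivefold (ms : seq move) :=
  has (fun p => 5 <= count (same_position p) (history ms)) (history ms).

Definition seventy_five (ms : seq move) :=
  (150 <= size ms) &&
  all (fun i => ~~ critical_ply ms i) (iota (size ms - 149) 150).

(* The precedence of checkmate over the seventy-five-move rule affects only   *)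
(* the result of the game, not the ply on which it ends.                      *)
Definition terminated (ms : seq move) : Prop :=
  let p := position_after ms (size ms) in
  checkmate p \/ stalemate p \/ dead p \/ fivefold ms \/ seventy_five ms.

Definition game (ms : seq move) : Prop :=
  [/\ legal_sequence initial_position ms,
      forall i, i < size ms -> ~ terminated (take i ms)
    & terminated ms].

Definition critical_plies (ms : seq move) : seq nat :=
  [seq i <- iota 1 (size ms) | critical_ply ms i].

Definition has_tail (ms : seq move) : bool :=
  let t := critical_plies ms in
  (t == [::]) ||
  has (fun i => (last 0 t < i) && ~~ critical_ply ms i) (iota 1 (size ms)).

Definition num_segments (ms : seq move) :=
  size (critical_plies ms) + has_tail ms.

Definition segment_ends (ms : seq move) : seq nat :=
  0 :: critical_plies ms ++ (if has_tail ms then [:: size ms] else [::]).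

(* The player who moves on ply i; this also gives Black for i = 0. *)
Definition ply_color (i : nat) := if odd i then White else Black.

Definition switch_count (ms : seq move) :=
  let e i := nth 0 (segment_ends ms) i in
  \sum_(1 <= i < (num_segments ms).+1)
     (ply_color (e i) != ply_color (e i.-1)).

Definition critical_colors (ms : seq move) : seq color :=
  map ply_color (critical_plies ms).

(* The maximal constant runs of s, in order. *)
Fixpoint blocks (s : seq color) : seq (seq color) :=
  if s is x :: s' then
    if blocks s' is (y :: r) :: rs
    then if x == y then (x :: y :: r) :: rs else [:: x] :: (y :: r) :: rs
    else [:: [:: x]]
  else [::].

(* Main.v *)
Require Import Defs.
From HB Require Import structures.
From mathcomp Require Import all_boot.
From mathcomp Require Import zify.

Set Implicit Arguments.
Unset Strict Implicit.
Unset Printing Implicit Defensive.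

(** Follow each of the 32 initial pieces through the game. Every critical move
is a quiet pawn move (a pawn move along its file) or a capture, so the number
of critical moves is at most the sum over the initial pieces of a credit: the
number of quiet moves that the piece makes as a pawn, plus 1 if it is captured
([critical_count]). An officer has credit at most 1. A pawn makes at most six
pawn moves, and its captures are not quiet, so its credit is at most 7 minus
the number of captures it makes as a pawn ([pawn_credit]).

Suppose that there are at most three blocks. Then the game splits into three
phases whose critical moves are all by X, all by Y and all by X, where Y is the
opponent of X. The pawns of Y stay at home during phase 1 unless they are
captured there; the pawns of X stay still during phase 2; and no piece of X is
captured in phases 1 and 3. Let us add the credits of the two pawns that start
on a given file.

- If no pawn of Y is captured in phase 1, these pawns form a wall, so that every
  pawn of X ends phase 1 as a pawn which is at least two ranks from promotion
  ([held_back]). If it is captured in phase 2, its credit is at most 5. If not,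
  it is never captured, so its credit is at most 6, and at most 5 if it ever
  makes a capture. If it makes none, it obstructs the file during the whole of
  phase 2, which comprises all the moves of the pawn of Y: this one captures
  something, makes a double step or never promotes ([blocked_file]), so its
  credit is at most 6. In all cases the file contributes at most 12
  ([file_all_alive]).
- Otherwise, a file whose pawn of Y is captured in phase 1 contributes at most
  1 + 7 ([file_dead]) and every other file at most 13 ([file_alive]), because
  its pawn of X leaves the file by a capture, or is held back as before.

With the 16 officers this gives at most 16 + 8 * 12 = 112 critical moves in the
first case and 16 + 8 + 7 * 13 = 115 in the second. But 118 segments require at
least 117 critical moves, so there are at least four blocks. The switches
between consecutive blocks are counted by the switch count, which is therefore
at least three. *)

(** * Colours, ranks and single moves *)

Lemma opponentK : involutive opponent. Proof. by case. Qed.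

Lemma eq_opponent c d : (c == opponent d) = (c != d).
Proof. by case: c; case: d; rewrite eqxx; apply/eqP. Qed.

Lemma opponent_neq c : opponent c <> c. Proof. by case: c. Qed.

Lemma rank_le7 (r : 'I_8) : r <= 7. Proof. by rewrite -ltnS. Qed.

Lemma rel_rank_le7 c s : rel_rank c s <= 7.
Proof. by case: c; rewrite /= ?leq_subr // rank_le7. Qed.

Lemma rel_rank_opponent c s : rel_rank (opponent c) s = 7 - rel_rank c s.
Proof. by case: c => //=; have := rank_le7 s.2; lia. Qed.

Lemma rel_rank_inj c (s s' : square) :
  s.1 = s'.1 -> rel_rank c s = rel_rank c s' -> s = s'.
Proof.
case: s s' => [f r] [f' r'] /= -> eq_r; congr (_, _); apply: val_inj => /=.
by move: eq_r; have := rank_le7 r; have := rank_le7 r'; case: c => /=; lia.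
Qed.

Lemma fdist_eq0 (a t : square) : (fdist a t == 0) = (a.1 == t.1).
Proof. by rewrite /fdist /dist -val_eqE /=; lia. Qed.

Lemma is_pawn_kind c k : is_pawn (Some (c, k)) = (k == Pawn).
Proof. by case: k; rewrite ?eqxx //; apply/esym/negbTE/eqP. Qed.

(** The square emptied by the capture, if the move is a capture. On a straight
pawn move it is the square [a] that the pawn leaves. *)
Definition victim (p : position) (a t : square) : square :=
  if is_pawn (pieces p a) && (pieces p t == None) then (t.1, a.2) else t.

(** The invariant that makes an en passant capture remove an enemy pawn: the
pawn that has just advanced two squares stands in front of the square that it
crossed. *)
Definition ep_pawn (p : position) := forall e, en_passant p = Some e ->
  exists s : square, [/\ s.1 = e.1,
    (rel_rank (turn p) s).+1 = rel_rank (turn p) e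
    & pieces p s = Some (opponent (turn p), Pawn)].

Lemma ep_victim p (a t : square) : ep_pawn p -> en_passant p = Some t ->
  rel_rank (turn p) t = (rel_rank (turn p) a).+1 ->
  pieces p (t.1, a.2) = Some (opponent (turn p), Pawn).
Proof.
move=> epP /epP[s [fs rs ps]] rt; suff -> : (t.1, a.2) = s by [].
apply: (@rel_rank_inj (turn p)) => //; move: rs; rewrite rt => -[->].
by case: (turn p).
Qed.

Lemma step_mover p a t pr :
  step_ok p a t pr -> exists k, pieces p a = Some (turn p, k).
Proof.
rewrite /step_ok; case: (pieces p a) => [[c k]|] // /and3P[/eqP-> _ _].
by exists k.
Qed.

Lemma pawn_advance p a t pr : step_ok p a t pr -> is_pawn (pieces p a) ->
  rel_rank (turn p) t = (rel_rank (turn p) a).+1 \/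
  [/\ a.1 = t.1, rel_rank (turn p) a = 1 & rel_rank (turn p) t = 3].
Proof.
rewrite /step_ok /pawn_can_reach.
case: (pieces p a) => [[c []]|] //= /and3P[_ _ +] _; rewrite eqxx.
case/or3P=> [/and3P[_ /eqP-> _]|/and5P[f0 /eqP-> /eqP-> _ _]|/andP[+ _]].
- by left.
- by right; split=> //; apply/eqP; rewrite -fdist_eq0.
- by case/andP=> _ /eqP->; left.
Qed.

Lemma step_result p a t pr k :
  step_ok p a t pr -> pieces p a = Some (turn p, k) ->
  exists k', pieces (play p (Step a t pr)) t = Some (turn p, k') /\
    (k' = Pawn <-> k = Pawn /\ rel_rank (turn p) t <> 7).
Proof.
rewrite /step_ok /promotion_ok => + pa; rewrite pa.
have -> : pieces (play p (Step a t pr)) t =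
    (if pr is Some k' then Some (turn p, k') else Some (turn p, k)).
  by rewrite /= ffunE eqxx pa.
case/and3P=> _ + _; have [/andP[/eqP-> /eqP->]|nprom] := ifP.
  rewrite !inE => /or4P[]/eqP->; eexists; split; try reflexivity;
  by split=> [|[_ /(_ erefl)]].
move/eqP->; exists k; split=> //; split=> [kP|[]//].
by split=> // t7; move: nprom; rewrite kP t7 !eqxx.
Qed.

Lemma victim_colour p a t pr s c k : ep_pawn p -> step_ok p a t pr ->
  s != a -> s = victim p a t -> pieces p s = Some (c, k) ->
  c = opponent (turn p).
Proof.
move=> epP; rewrite /step_ok /pawn_can_reach /victim.
case pa: (pieces p a) => [[c' k']|] // /and3P[_ _].
rewrite is_pawn_kind.
case: (altP (k' =P Pawn)) => [_|_] /=; last first.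
  case/andP=> _ cap _ -> pt; move: cap; rewrite pt /=.
  by case/andP=> /eqP.
case/or3P.
- case/and3P=> + _ ->; rewrite fdist_eq0 => /eqP <- /= /eqP + sE.
  by rewrite sE -surjective_pairing.
- case/and5P=> + _ _ _ ->; rewrite fdist_eq0 => /eqP <- /= /eqP + sE.
  by rewrite sE -surjective_pairing.
- case/andP=> /andP[_ /eqP rt] /orP[|/andP[/eqP pt /eqP ep]].
    case pt: (pieces p t) => [[ct kt]|] //= /andP[/eqP ctE _] _ ->.
    by rewrite pt ctE => -[].
  by rewrite pt eqxx => _ ->; rewrite (ep_victim epP ep rt) => -[].
Qed.

Lemma pawn_takes p a t pr : ep_pawn p -> step_ok p a t pr ->
  is_pawn (pieces p a) -> a.1 != t.1 ->
  victim p a t != a /\ pieces p (victim p a t) <> None.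
Proof.
move=> epP ok paw at1; split.
  by apply: contra at1 => /eqP; rewrite /victim; case: ifP => _ <-.
move: ok paw; rewrite /step_ok /pawn_can_reach /victim.
case pa: (pieces p a) => [[c' []]|] //= /and3P[_ _] + _.
rewrite eqxx fdist_eq0 (negPf at1) /=.
case/andP=> /andP[_ /eqP rt] /orP[|/andP[/eqP pt /eqP ep]].
  by case pt: (pieces p t) => [[ct kt]|] //=; rewrite pt.
by rewrite pt eqxx (ep_victim epP ep rt).
Qed.

Lemma officer_moves p a t pr :
  step_ok p a t pr -> ~~ is_pawn (pieces p a) -> t != a.
Proof.
rewrite /step_ok; case pa: (pieces p a) => [[c k]|] // + npaw.
rewrite -(is_pawn_kind c) (negPf npaw) => /and3P[/eqP cE _ /andP[_ cap]].
apply: contraTneq cap => ->; rewrite pa /= cE.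
by case: (turn p); rewrite eq_opponent eqxx.
Qed.

Lemma ep_pawn_play p m : legal p m -> ep_pawn (play p m).
Proof.
case: m => [a t pr|sd] //= /andP[ok _] e /=; case: ifP => // /andP[paw r2] [<-].
have [k pa] := step_mover ok.
have := pawn_advance ok paw.
move: paw; rewrite pa; case: k pa => // pa _ adv.
have [k' [pt kP]] := step_result ok pa.
have [a1 ra rt] :
    [/\ a.1 = t.1, rel_rank (turn p) a = 1 & rel_rank (turn p) t = 3].
  case: adv => // adv; exfalso; move: r2 adv; rewrite /rdist /dist.
  by have := rank_le7 a.2; have := rank_le7 t.2; case: (turn p) => /=; lia.
have kP' : k' = Pawn by apply/kP; rewrite rt.
exists t; split=> //=; last by rewrite opponentK pt kP'.
rewrite !rel_rank_opponent rt.
case: (turn p) ra rt => /= ra rt; rewrite inordK; lia.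
Qed.

Lemma castle_squares c sd :
  [/\ king_castled c sd != king_home c, king_castled c sd != rook_home c sd,
      rook_castled c sd != king_home c, rook_castled c sd != rook_home c sd
    & rook_home c sd != king_home c] /\
  [/\ king_castled c sd != rook_castled c sd,
      between (king_home c) (rook_home c sd) (king_castled c sd)
    & between (king_home c) (rook_home c sd) (rook_castled c sd)].
Proof.
rewrite /between /orthogonal /fdist /rdist /dist.
rewrite /king_castled /rook_castled /king_home /rook_home /sq.
rewrite !xpair_eqE -!val_eqE /=.
by case: c; case: sd; rewrite /= !inordK.
Qed.

Lemma castle_pieces p sd : castle_ok p sd ->
  [/\ pieces p (king_home (turn p)) = Some (turn p, King),
      pieces p (rook_home (turn p) sd) = Some (turn p, Rook),
      pieces p (king_castled (turn p) sd) = None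
    & pieces p (rook_castled (turn p) sd) = None].
Proof.
case/and5P=> _ /eqP-> /eqP-> /forallP cl _.
have [_ [_ kb rb]] := castle_squares (turn p) sd.
by split=> //; apply/eqP; [move: kb|move: rb]; apply/implyP.
Qed.

(** * Following a piece *)

Definition follow (p : position) (m : move) (s : square) : option square :=
  match m with
  | Step a t _ =>
      if s == a then Some t else if s == victim p a t then None else Some s
  | Castle sd =>
      Some (if s == king_home (turn p) then king_castled (turn p) sd
            else if s == rook_home (turn p) sd then rook_castled (turn p) sd
            else s)
  end.

Definition pawn_move (p : position) (m : move) (s : square) : bool :=
  if m is Step a _ _ then (s == a) && is_pawn (pieces p a) else false.

Definition straight (m : move) : bool :=
  if m is Step a t _ then a.1 == t.1 else true.

Lemma pawn_move_critical p m s : pawn_move p m s -> critical p m.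
Proof. by case: m => //= a t _ /andP[_ ->]. Qed.

Lemma step_board_other p a t pr s : s != a -> s != t -> s != victim p a t ->
  step_board p a t pr s = pieces p s.
Proof.
rewrite ffunE /victim => /negPf-> /negPf->.
by rewrite andbA; case: ifP => //= _ /negPf->.
Qed.

(** The fate of one piece on one ply. Every invariant of a given piece is read off
from this description instead of the rules of the game. *)
Lemma follow_piece p m s c k :
  ep_pawn p -> legal p m -> pieces p s = Some (c, k) ->
  if follow p m s is Some s' then
    exists k', pieces (play p m) s' = Some (c, k') /\
    (if pawn_move p m s then
       [/\ c = turn p, k = Pawn, straight m = (s.1 == s'.1),
           rel_rank c s' = (rel_rank c s).+1 \/
           [/\ s.1 = s'.1, rel_rank c s = 1 & rel_rank c s' = 3]
         & k' = Pawn <-> rel_rank c s' <> 7]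
     else (k' = Pawn <-> k = Pawn) /\ (k = Pawn -> s' = s))
  else [/\ c = opponent (turn p), critical p m & ~~ pawn_move p m s].
Proof.
move=> epP; case: m => [a t pr|sd] /andP[ok _] ps.
  rewrite /follow /pawn_move /straight; have [sa|sa] := eqVneq s a.
    subst a; have [k0] := step_mover ok; rewrite ps => -[cE _].
    have pa : pieces p s = Some (turn p, k) by rewrite ps cE.
    have [k' [pt k'P]] := step_result ok pa.
    exists k'; rewrite cE; split=> //; rewrite andTb ?pa is_pawn_kind.
    case: eqP k'P => [kp|kp] k'P; last by split=> //; split=> [/k'P[]|].
    split=> //; last by rewrite k'P; split=> [[]|].
    by have := pawn_advance ok; rewrite pa kp => /(_ isT); apply.
  case: eqP => [sv|/eqP sv]; last first.
    exists k; split=> //; have [st|st] := eqVneq s t; last first.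
      by rewrite -ps; apply: step_board_other.
    move: sv; rewrite -st /victim.
    by case: ifP => [/andP[_ /eqP]|]; rewrite ?ps ?eqxx.
  split=> //; first exact: victim_colour epP ok sa sv ps.
  move: sv; rewrite /= /victim; case: ifP => [/andP[-> _] //|_ <-].
  by rewrite ps orbT.
have [king rook k0 r0] := castle_pieces ok.
have [[kk kr rk rr rk0] [kr' _ _]] := castle_squares (turn p) sd.
rewrite /follow /= !ffunE.
case: (altP (s =P king_home _)) ps => [->|sk].
  rewrite king eqxx => -[<- <-]; exists King; split=> //; split=> //.
case: (altP (s =P rook_home _ _)) => [->|sr ps].
  rewrite rook eq_sym (negPf kr') eqxx => -[<- <-].
  by exists Rook; split.
have sk' : s != king_castled (turn p) sd.
  by apply: contraTneq isT => sE; rewrite sE k0 in ps.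
have sr' : s != rook_castled (turn p) sd.
  by apply: contraTneq isT => sE; rewrite sE r0 in ps.
exists k; split; last by split.
by rewrite (negPf sk') (negPf sr') (negPf sk) (negPf sr).
Qed.

(** What is recorded of one initial piece: its square unless it is captured, and
the numbers of straight and of capturing moves that it has made as a pawn. *)
Record trail := Trail { loc : option square; quiet : nat; takes : nat }.

Definition trail_step (p : position) (m : move) (y : trail) : trail :=
  if loc y is Some s then
    Trail (follow p m s) (quiet y + (pawn_move p m s && straight m))
      (takes y + (pawn_move p m s && ~~ straight m))
  else y.

(** An initial piece is given by its colour, its file, and whether it is a
pawn. *)
Notation piece := (color * 'I_8 * bool)%type.

Definition home (x : piece) : square :=
  (x.1.2, inord (if x.1.1 is White then x.2 : nat else 7 - x.2)).

Lemma rel_rank_home (x : piece) : rel_rank x.1.1 (home x) = x.2.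
Proof. by case: x => [[[] f] []]; rewrite /= inordK. Qed.

Lemma initial_home (x : piece) : exists k,
  initial_board (home x) = Some (x.1.1, k) /\ (k = Pawn <-> x.2).
Proof.
have off f :
    nth King [:: Rook; Knight; Bishop; Queen; King; Bishop; Knight; Rook] f
      <> Pawn by case: f => [|[|[|[|[|[|[|[|[]]]]]]]]].
by case: x => [[[] f] []]; rewrite ffunE /= inordK //=; eexists;
  split; try reflexivity; split=> // /off.
Qed.

Lemma initial_home_onto s :
  initial_board s <> None -> exists x : piece, s = home x.
Proof.
case: s => f r; rewrite ffunE /=.
have at_home c (b : bool) :
    nat_of_ord r = (if c is White then b : nat else 7 - b) ->
    exists x : piece, (f, r) = home x.
  move=> rE; exists (c, f, b); rewrite /home; congr (_, _); apply: val_inj.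
  by rewrite /= -rE inordK.
case rE: (nat_of_ord r) => [|[|[|[|[|[|[|[|n]]]]]]]] // _.
- exact: (at_home White false).
- exact: (at_home White true).
- exact: (at_home Black true).
- exact: (at_home Black false).
Qed.

(** Each pawn move gains at least one rank and a pawn starts on rank 1, whence
the strict inequality while the piece is still a pawn. *)
Definition tracked (p : position) (x : piece) (y : trail) : Prop :=
  quiet y + takes y <= 6 * x.2 /\
  if loc y is Some s then exists k, pieces p s = Some (x.1.1, k) /\
    (k = Pawn -> [/\ x.2, quiet y + takes y < rel_rank x.1.1 s
                   & takes y = 0 -> s.1 = x.1.2])
  else True.

Lemma tracked_initial x :
  tracked initial_position x (Trail (Some (home x)) 0 0).
Proof.
split=> //=; have [k [-> kP]] := initial_home x; exists k; split=> // /kP x2.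
by rewrite rel_rank_home x2.
Qed.

Lemma tracked_play p m x y : ep_pawn p -> legal p m -> tracked p x y ->
  tracked (play p m) x (trail_step p m y).
Proof.
move=> epP lg [le6]; rewrite /trail_step.
case: y le6 => [[s|] q tk] /= le6; last by [].
case=> k [ps kP]; have := follow_piece epP lg ps.
rewrite /tracked /=; case: (follow p m s) => [s'|]; last first.
  by case=> _ _ /negPf->; rewrite !addn0.
case=> k' [ps']; case: (pawn_move p m s); last first.
  case=> k'k ss; rewrite !addn0; split=> //; exists k'; split=> // /k'k kp.
  by rewrite ss //; apply: kP.
case=> _ kp -> adv k'P; have [x2 lt file] := kP kp.
have := rel_rank_le7 x.1.1 s'; have eq_sum : q + (true && (s.1 == s'.1)) +
    (tk + (true && (s.1 != s'.1))) = (q + tk).+1 by case: (_ == _); lia.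
rewrite eq_sum => le7; have lt' : (q + tk).+1 < rel_rank x.1.1 s'.
  by case: adv => [->|[_ rs ->]]; rewrite ?ltnS // ; move: lt; rewrite rs; lia.
split; first by rewrite x2; lia.
exists k'; split=> // _; split=> //.
case: eqP => [<-|_] /=; last by lia.
by rewrite addn0.
Qed.

Lemma trail_step_lost p m y : loc y = None -> trail_step p m y = y.
Proof. by rewrite /trail_step => ->. Qed.

Lemma not_lost p m x y : ep_pawn p -> legal p m -> tracked p x y ->
  (critical p m -> turn p <> opponent x.1.1) ->
  loc y <> None -> loc (trail_step p m y) <> None.
Proof.
move=> epP lg [_]; rewrite /trail_step.
case: (loc y) => [s|] // [k [ps _]] idle _ /=.
have := follow_piece epP lg ps; case: (follow p m s) => // -[cE /idle].
by rewrite cE opponentK.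
Qed.

Lemma idle_counts p m x y : ep_pawn p -> legal p m -> tracked p x y ->
  (critical p m -> turn p <> x.1.1) ->
  quiet (trail_step p m y) = quiet y /\ takes (trail_step p m y) = takes y.
Proof.
move=> epP lg [_]; rewrite /trail_step.
case: (loc y) => [s|] // [k [ps _]] idle /=.
have [pm|_] := boolP (pawn_move p m s); last by rewrite !addn0.
have := follow_piece epP lg ps; rewrite pm.
case: (follow p m s) => [s'|[_ _]//].
by case=> k' [_ [cE]]; case: (idle (pawn_move_critical pm)).
Qed.

Definition pawn_at (p : position) (x : piece) (y : trail) (s : square) :=
  loc y = Some s /\ pieces p s = Some (x.1.1, Pawn).

Lemma pawn_ply p m x y s : ep_pawn p -> legal p m -> tracked p x y ->
  pawn_at p x y s ->
  let y' := trail_step p m y in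
  match loc y' with
  | Some s' =>
     s' = s /\ [/\ pawn_at (play p m) x y' s, quiet y' = quiet y
                & takes y' = takes y]
     \/ [/\ critical p m, turn p = x.1.1,
            rel_rank x.1.1 s' = (rel_rank x.1.1 s).+1 \/
              rel_rank x.1.1 s = 1 /\ rel_rank x.1.1 s' = 3,
            rel_rank x.1.1 s' <> 7 -> pawn_at (play p m) x y' s'
          & quiet y' + takes y' = (quiet y + takes y).+1]
  | None => quiet y' = quiet y /\ takes y' = takes y
  end.
Proof.
move=> epP lg tr [ls ps]; rewrite /trail_step ls /= /pawn_at.
have := follow_piece epP lg ps; case: (follow p m s) => [s'|]; last first.
  by case=> _ _ /negPf->; rewrite !addn0.
case=> k' [ps']; have [pm|pm] := boolP (pawn_move p m s); last first.
  move=> [k'P ss]; have s's := ss erefl; left; subst s'.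
  rewrite !addn0; split=> //; split=> //.
  by rewrite ps' (proj2 k'P erefl).
move=> [cE _ _ adv k'P]; right; split=> //.
- exact: pawn_move_critical pm.
- by case: adv => [|[]]; [left|right].
- by move/k'P => <-.
- by case: (straight m); rewrite /= ?addn0 ?addn1 ?addnS ?addSn.
Qed.

(** * Counting critical moves along a game *)

(** Ply number [i + 1] is the move with index [i]. *)
Definition ply_move (ms : seq move) i := nth (Castle KingSide) ms i.

Lemma position_after_succ ms i : i < size ms ->
  position_after ms i.+1 = play (position_after ms i) (ply_move ms i).
Proof.
move=> lt; rewrite /position_after (take_nth (Castle KingSide)) //.
by rewrite foldl_rcons.
Qed.

Lemma legal_ply ms i : legal_sequence initial_position ms -> i < size ms ->
  legal (position_after ms i) (ply_move ms i).
Proof.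
rewrite /position_after /ply_move; elim: ms i initial_position => //=.
move=> m ms IH [|i] p /andP[lg lgs] //=.
by rewrite ltnS; apply: IH.
Qed.

Fixpoint trail_after (ms : seq move) (x : piece) i : trail :=
  if i is j.+1
  then trail_step (position_after ms j) (ply_move ms j) (trail_after ms x j)
  else Trail (Some (home x)) 0 0.

Definition critical_move ms i :=
  critical (position_after ms i) (ply_move ms i).

Lemma turn_after ms i :
  i <= size ms -> turn (position_after ms i) = ply_color i.+1.
Proof.
elim: i => [|i IH] lt; first by rewrite /position_after take0.
rewrite position_after_succ //.
have -> q m : turn (play q m) = opponent (turn q) by case: m.
by rewrite IH ?(ltnW lt) // /ply_color /=; case: (odd i).
Qed.

Section Run.
Variables (ms : seq move).
Hypothesis lg : legal_sequence initial_position ms.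
Local Notation P := (position_after ms).
Local Notation tr := (trail_after ms).
Local Notation L := (size ms).

Lemma ep_pawn_after i : i <= L -> ep_pawn (P i).
Proof.
case: i => [|i] lt; first by rewrite /position_after take0 => e.
by rewrite position_after_succ //; apply: ep_pawn_play; apply: legal_ply.
Qed.

Lemma tracked_after x i : i <= L -> tracked (P i) x (tr x i).
Proof.
elim: i => [|i IH] lt.
  by rewrite /position_after take0; apply: tracked_initial.
rewrite position_after_succ //; apply: tracked_play; last exact/IH/ltnW.
  exact/ep_pawn_after/ltnW.
exact: legal_ply.
Qed.

Lemma pawn_at_trail x i s : i <= L -> pawn_at (P i) x (tr x i) s ->
  quiet (tr x i) + takes (tr x i) < rel_rank x.1.1 s /\
  (takes (tr x i) = 0 -> s.1 = x.1.2).
Proof.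
move=> iL [ls ps]; have [_] := tracked_after x iL; rewrite ls ps.
by case=> k [[<-]] /(_ erefl)[].
Qed.

Lemma pawn_at_colour x x' s i : i <= L -> pawn_at (P i) x (tr x i) s ->
  loc (tr x' i) = Some s -> x'.1.1 = x.1.1.
Proof.
move=> iL [_ ps] l'; have [_] := tracked_after x' iL.
by rewrite l' ps => -[k [[-> _] _]].
Qed.

Lemma occupied_tracked s i : i <= L -> pieces (P i) s <> None ->
  exists x, loc (tr x i) = Some s.
Proof.
elim: i s => [|i IH] s lt.
  by rewrite /position_after take0 => /initial_home_onto[x ->]; exists x.
have {}IH s' : pieces (P i) s' <> None -> exists x, loc (tr x i) = Some s'.
  exact/IH/ltnW.
have stp x s0 : loc (tr x i) = Some s0 ->
    loc (tr x i.+1) = follow (P i) (ply_move ms i) s0.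
  by rewrite /= /trail_step => ->.
suff: pieces (P i.+1) s <> None -> exists s0,
    pieces (P i) s0 <> None /\ follow (P i) (ply_move ms i) s0 = Some s.
  by move=> H /H[s0 [/IH[x /stp xE] f]]; exists x; rewrite xE.
rewrite position_after_succ //.
have := legal_ply lg lt; 
case: (ply_move ms i) => [a t pr|sd] /andP[ok _] /=.
  have [-> _|st] := eqVneq s t.
    by have [k pa] := step_mover ok; exists a; rewrite pa eqxx.
  rewrite ffunE (negPf st); have [//|sa] := eqVneq s a.
  case: ifP => // nv ps; exists s; split=> //; rewrite (negPf sa) /victim.
  move: nv; rewrite andbA; case: (_ && (pieces _ t == None)) => /= [->|_] //.
  by rewrite (negPf st).
have [king rook k0 r0] := castle_pieces ok.
have [[kk kr rk rr rk0] [kr' _ _]] := castle_squares (turn (P i)) sd.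
rewrite ffunE; case: eqP => [-> _|_].
  by exists (king_home (turn (P i))); rewrite king eqxx.
case: eqP => [-> _|_].
  by exists (rook_home (turn (P i)) sd); rewrite rook (negPf rk0) eqxx.
by case: ifP => // /norP[/negPf kn /negPf rn] ps; exists s; rewrite kn rn.
Qed.

(** The piece is credited with its own quiet pawn moves and with its capture, so
that a capturing pawn move is credited to its victim only. *)
Definition credit x i := quiet (tr x i) + (loc (tr x i) == None).

Lemma credit_mono x i : credit x i <= credit x i.+1.
Proof.
rewrite /credit /= /trail_step.
case lE: (loc (tr x i)) => [s|] //=; last by rewrite lE.
by rewrite addn0 -addnA leq_addr.
Qed.

Lemma critical_credit i : i < L -> critical_move ms i ->
  exists x, credit x i < credit x i.+1.
Proof.
move=> lt; rewrite /critical_move.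
have := legal_ply lg lt; 
have epP := ep_pawn_after (ltnW lt).
have cred x s : loc (tr x i) = Some s ->
    pawn_move (P i) (ply_move ms i) s && straight (ply_move ms i) ||
    (follow (P i) (ply_move ms i) s == None) -> credit x i < credit x i.+1.
  by rewrite /credit /= /trail_step => -> /= /orP[->|->]; rewrite /=; lia.
move: cred; case: (ply_move ms i) => [a t pr|sd] cred // /andP[ok _].
have occ s := @occupied_tracked s i (ltnW lt).
have [k pa] := step_mover ok.
have capt : victim (P i) a t != a -> pieces (P i) (victim (P i) a t) <> None ->
    exists x, credit x i < credit x i.+1.
  move=> va /occ[x xE]; exists x; apply: (cred x _ xE).
  by rewrite /= (negPf va) eqxx orbT.
have [paw|npaw] := boolP (is_pawn (pieces (P i) a)).
  move=> _; have [at1|at1] := eqVneq a.1 t.1.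
    have [|x xE] := occ a; first by rewrite pa.
    by exists x; apply: (cred x _ xE); rewrite /= eqxx paw at1 eqxx.
  by have [] := pawn_takes epP ok paw at1.
rewrite /critical (negPf npaw) /= => /eqP pt.
apply: capt; rewrite /victim (negPf npaw) //=.
exact: officer_moves ok npaw.
Qed.

Lemma critical_count i : i <= L ->
  \sum_(j < i) critical_move ms j <= \sum_x credit x i.
Proof.
elim: i => [|i IH] lt; first by rewrite big_ord0.
rewrite big_ord_recr /=.
apply: leq_trans (leq_add (IH (ltnW lt)) (leqnn _)) _.
have [cm|_] := boolP (critical_move ms i); last first.
  by rewrite addn0; apply: leq_sum => x _; apply: credit_mono.
have [x lx] := critical_credit lt cm.
rewrite (bigD1 x) //= [leqRHS](bigD1 x) //= addn1 -addSn.
by apply: leq_add lx _; apply: leq_sum => y _; apply: credit_mono.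
Qed.

Lemma pawn_credit c f : credit (c, f, true) L + takes (tr (c, f, true) L) <= 7.
Proof.
have [le6 _] := tracked_after (c, f, true) (leqnn L).
rewrite /credit addnAC.
by apply: (leq_add (n1 := 6) (n2 := 1)) => //; apply: leq_b1.
Qed.

Lemma officer_credit c f : credit (c, f, false) L <= 1.
Proof.
have [le0 _] := tracked_after (c, f, false) (leqnn L).
by move: le0; rewrite /credit /=; case: eqP; lia.
Qed.
End Run.

(** * Three phases *)

Lemma interval_ind (Q : nat -> Prop) i j : Q i ->
  (forall k, i <= k < j -> Q k -> Q k.+1) -> forall k, i <= k <= j -> Q k.
Proof.
move=> Qi QS; elim=> [|k IH] /andP[ik kj].
  by move: ik Qi; rewrite leqn0 => /eqP->.
move: ik; rewrite leq_eqVlt => /orP[/eqP<-//|ik].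
apply: QS; first by rewrite kj andbT.
by apply: IH; rewrite -ltnS ik ltnW.
Qed.

Section Phases.
Variables (ms : seq move).
Hypothesis lg : legal_sequence initial_position ms.
Local Notation P := (position_after ms).
Local Notation tr := (trail_after ms).
Local Notation L := (size ms).

Definition inactive c i j :=
  forall k, i <= k < j -> critical_move ms k -> turn (P k) <> c.

Lemma lost_forever x i j : i <= j -> loc (tr x i) = None -> tr x j = tr x i.
Proof.
move=> ij li; apply: (@interval_ind (fun k => tr x k = tr x i) i j) => //.
  by move=> k _ /= E; rewrite E trail_step_lost.
by rewrite ij leqnn.
Qed.

Lemma takes_mono x i j : i <= j -> takes (tr x i) <= takes (tr x j).
Proof.
move=> ij.
apply: (@interval_ind (fun k => takes (tr x i) <= takes (tr x k)) i j) => //.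
  move=> k _ /leq_trans; apply; rewrite /= /trail_step.
  by case: (loc _) => //= s; apply: leq_addr.
by rewrite ij leqnn.
Qed.

Lemma survives x i j : i <= j <= L -> inactive (opponent x.1.1) i j ->
  loc (tr x i) <> None -> loc (tr x j) <> None.
Proof.
move=> /andP[ij jL] ina li.
apply: (@interval_ind (fun k => loc (tr x k) <> None) i j) => //.
  move=> k /andP[ik kj] lk; have kL := leq_trans kj jL.
  apply: not_lost (ep_pawn_after lg (ltnW kL)) (legal_ply lg kL)
    (tracked_after lg x (ltnW kL)) _ lk.
  by apply: ina; rewrite ik kj.
by rewrite ij leqnn.
Qed.

Lemma inactive_counts x i j : i <= j <= L -> inactive x.1.1 i j ->
  quiet (tr x j) = quiet (tr x i) /\ takes (tr x j) = takes (tr x i).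
Proof.
move=> /andP[ij jL] ina.
apply: (@interval_ind (fun k => quiet (tr x k) = quiet (tr x i) /\
  takes (tr x k) = takes (tr x i)) i j) => //.
  move=> k /andP[ik kj] [<- <-]; have kL := leq_trans kj jL.
  apply: idle_counts (ep_pawn_after lg (ltnW kL)) (legal_ply lg kL)
    (tracked_after lg x (ltnW kL)) _.
  by apply: ina; rewrite ik kj.
by rewrite ij leqnn.
Qed.

Lemma pawn_ply_after x i s : i < L -> pawn_at (P i) x (tr x i) s ->
  match loc (tr x i.+1) with
  | Some s' =>
     s' = s /\ [/\ pawn_at (P i.+1) x (tr x i.+1) s,
                   quiet (tr x i.+1) = quiet (tr x i)
                 & takes (tr x i.+1) = takes (tr x i)]
     \/ [/\ critical_move ms i, turn (P i) = x.1.1,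
            rel_rank x.1.1 s' = (rel_rank x.1.1 s).+1 \/
              rel_rank x.1.1 s = 1 /\ rel_rank x.1.1 s' = 3,
            rel_rank x.1.1 s' <> 7 -> pawn_at (P i.+1) x (tr x i.+1) s'
          & quiet (tr x i.+1) + takes (tr x i.+1)
              = (quiet (tr x i) + takes (tr x i)).+1]
  | None => quiet (tr x i.+1) = quiet (tr x i) /\
            takes (tr x i.+1) = takes (tr x i)
  end.
Proof.
move=> iL; rewrite position_after_succ //.
exact: pawn_ply (ep_pawn_after lg (ltnW iL)) (legal_ply lg iL)
  (tracked_after lg x (ltnW iL)).
Qed.

Lemma inactive_pawn x i j s : i <= j <= L -> inactive x.1.1 i j ->
  pawn_at (P i) x (tr x i) s ->
  loc (tr x j) = None \/ pawn_at (P j) x (tr x j) s.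
Proof.
move=> /andP[ij jL] ina pi.
apply: (@interval_ind (fun k =>
  loc (tr x k) = None \/ pawn_at (P k) x (tr x k) s) i j) => //.
- by right.
- move=> k /andP[ik kj]; have kL := leq_trans kj jL.
  case=> [lk|/(pawn_ply_after kL)].
    by left; rewrite (lost_forever (leqnSn k)).
  case: (loc (tr x k.+1)) => [s'|] H; last by left.
  case: H => [[_ []]|[cm tk _ _ _]]; first by right.
  by case: (ina k _ cm tk); rewrite ik kj.
by rewrite ij leqnn.
Qed.

Variables (X : color) (n1 n2 : nat).
Hypotheses (n12 : n1 <= n2) (n2L : n2 <= L).
Local Notation Y := (opponent X).
Hypotheses (phase1 : inactive Y 0 n1) (phase2 : inactive X n1 n2).
Hypothesis phase3 : inactive Y n2 L.

Definition alive f := loc (tr (Y, f, true) n1) != None.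

Lemma waiting_pawn f i : i <= n1 ->
  [/\ quiet (tr (Y, f, true) i) = 0, takes (tr (Y, f, true) i) = 0
    & alive f ->
      pawn_at (P i) (Y, f, true) (tr (Y, f, true) i) (home (Y, f, true))].
Proof.
move=> in1; have iL : 0 <= i <= L by lia.
have ina : inactive Y 0 i by move=> k kP; apply: phase1; lia.
have [-> ->] := inactive_counts (x := (Y, f, true)) iL ina; split=> // al.
have ini :
    pawn_at (P 0) (Y, f, true) (tr (Y, f, true) 0) (home (Y, f, true)).
  split=> //; rewrite /position_after take0 /=.
  have [k [-> kP]] := initial_home (Y, f, true).
  by rewrite (proj2 kP isT).
have [l0|//] := inactive_pawn (x := (Y, f, true)) iL ina ini.
by move: al; rewrite /alive (lost_forever in1 l0) l0.
Qed.

(** To reach its rank 6 a pawn of [X] must stand where a pawn of [Y] stood at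
home, so that the pawn of [Y] on that file has been captured. By assumption this
is not the file [f] on which the pawn of [X] started, so that this pawn has
changed file. *)
Lemma held_back f i : alive f -> i <= n1 ->
  (exists s, pawn_at (P i) (X, f, true) (tr (X, f, true) i) s /\
             rel_rank X s <= 5) \/
  0 < takes (tr (X, f, true) i) /\ exists g, ~~ alive g.
Proof.
move=> al in1; set x := (X, f, true).
apply: (@interval_ind (fun i =>
  (exists s, pawn_at (P i) x (tr x i) s /\ rel_rank X s <= 5) \/
  0 < takes (tr x i) /\ exists g, ~~ alive g) 0 n1) => //.
  left; exists (home x); rewrite (rel_rank_home x); split=> //; split=> //.
  rewrite /position_after take0 /=; have [k [-> kP]] := initial_home x.
  by rewrite (proj2 kP isT).
move=> k /andP[_ kn]; have kL : k < L by lia.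
case=> [[s [ps rs]]|[tk g]]; last first.
  by right; split=> //; apply: leq_trans tk (takes_mono x (leqnSn k)).
have live : loc (tr x k.+1) <> None.
  apply: (@survives x 0 k.+1) => //; by move=> j jP; apply: phase1; lia.
have := pawn_ply_after kL ps; case lE: (loc (tr x k.+1)) => [s'|] //.
case=> [[s's [ps' _ _]]|[_ _ adv ps' _]]; first by left; exists s.
have r6 : rel_rank X s' <= 6 by case: adv => [|[]] /=; lia.
have {}ps' : pawn_at (P k.+1) x (tr x k.+1) s' by apply: ps' => /=; lia.
move: r6; rewrite leq_eqVlt ltnS => /orP[/eqP r6|r5]; last by left; exists s'.
have s'E : s' = home (Y, s'.1, true).
  apply: (@rel_rank_inj Y) => //.
  by rewrite (rel_rank_home (Y, s'.1, true)) rel_rank_opponent r6.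
have dead : ~~ alive s'.1.
  apply/negP => al'; have [_ _ /(_ al')[lh _]] := waiting_pawn s'.1 kn.
  rewrite -s'E in lh.
  by have /= := pawn_at_colour lg kL ps' lh; apply: opponent_neq.
right; split; last by exists s'.1.
have [_ file] := pawn_at_trail lg kL ps'.
by rewrite lt0n; apply: contraNneq dead => tk0; rewrite file.
Qed.

Lemma nonpawn_ply x i : i < L -> (forall s, ~ pawn_at (P i) x (tr x i) s) ->
  [/\ quiet (tr x i.+1) = quiet (tr x i), takes (tr x i.+1) = takes (tr x i)
    & forall s, ~ pawn_at (P i.+1) x (tr x i.+1) s].
Proof.
move=> iL; rewrite position_after_succ //= /pawn_at /trail_step.
have [_] := tracked_after lg x (ltnW iL).
case lE: (loc (tr x i)) => [s0|]; last by split=> // s []; rewrite lE.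
case=> k [ps0 _] nop.
have kp : k <> Pawn by move=> kp; apply: (nop s0); rewrite ps0 kp.
have := follow_piece (ep_pawn_after lg (ltnW iL)) (legal_ply lg iL) ps0.
case: (follow _ _ s0) => [s'|[_ _ /negPf->]]; last first.
  by rewrite !addn0; split=> // s [].
case=> k' [ps']; case: ifP => [_ []//|_ [k'P _]].
rewrite !addn0; split=> // s [[<-]].
by rewrite ps' => -[/k'P].
Qed.

Lemma pawn_atVnot x i : (exists s, pawn_at (P i) x (tr x i) s) \/
  (forall s, ~ pawn_at (P i) x (tr x i) s).
Proof.
rewrite /pawn_at; case: (loc (tr x i)) => [s|]; last by right=> s [].
case: (pieces (P i) s =P Some (x.1.1, Pawn)) => [ps|ps].
  by left; exists s.
by right=> s' [[<-]].
Qed.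

(** In phase 2 the pawn of [X] is an obstacle that stands still on [s]. A pawn
of [Y] that stays on the file [f] and gains one rank per move would have to land
on [s] before promoting. If it makes a double step instead, it has at most five
moves in all. *)
Lemma blocked_file f s :
  alive f -> s.1 = f -> 0 < rel_rank X s <= 5 ->
  (forall i, n1 <= i <= n2 -> loc (tr (X, f, true) i) = Some s) ->
  quiet (tr (Y, f, true) n2) <= 5 \/ 0 < takes (tr (Y, f, true) n2).
Proof.
move=> al sf rs xs; set y := (Y, f, true).
(* The invariant: the pawn has made a capture, or it has made at most five
   quiet moves and, unless it has promoted or been captured, it has made a double
   step or has not reached the rank of [s]. *)
have rY : 1 < rel_rank Y s <= 6 by rewrite rel_rank_opponent; lia.
suff : 0 < takes (tr y n2) \/ quiet (tr y n2) <= 5 /\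
    forall s', pawn_at (P n2) y (tr y n2) s' ->
    (quiet (tr y n2)).+1 < rel_rank Y s' \/ rel_rank Y s' < rel_rank Y s.
  by case=> [tk|[q _]]; [right|left].
apply: (@interval_ind (fun i => 0 < takes (tr y i) \/ quiet (tr y i) <= 5 /\
    forall s', pawn_at (P i) y (tr y i) s' ->
    (quiet (tr y i)).+1 < rel_rank Y s' \/ rel_rank Y s' < rel_rank Y s) n1 n2).
- have [-> _ /(_ al)[lh ph]] := waiting_pawn f (leqnn n1).
  right; split=> // s' [ls' _]; right; move: ls'; rewrite lh => -[<-].
  by rewrite (rel_rank_home y) /=; lia.
- move=> k /andP[nk kn]; have kL : k < L by lia.
  case=> [tk|[q5 beh]].
    by left; apply: leq_trans tk (takes_mono y (leqnSn k)).
  have [tk0|] := posnP (takes (tr y k.+1)); last by left.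
  have tk : takes (tr y k) = 0.
    by apply/eqP; rewrite -leqn0 -tk0; apply: (takes_mono y (leqnSn k)).
  right; case: (pawn_atVnot y k) => [[s0 p0]|np]; last first.
    have [-> _ np'] := nonpawn_ply kL np; split=> // s' ps'.
    by case: (np' s').
  have [lt0 _] := pawn_at_trail lg (ltnW kL) p0; rewrite tk addn0 in lt0.
  have := pawn_ply_after kL p0; case lE: (loc (tr y k.+1)) => [s'|]; last first.
    by case=> -> _; split=> // s' []; rewrite lE.
  case=> [[_ [p0'' -> _]]|[_ _ adv pr']].
    by split=> // s1 [l1 _]; apply: beh; case: p0'' => + _; rewrite l1 => -[->].
  rewrite tk tk0 !addn0 => ->.
  have r7 := rel_rank_le7 Y s'; move: (beh _ p0) => /= {}beh.
  move: adv pr' lt0 => /= adv pr' lt0.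
  have ns : rel_rank Y s' <> rel_rank Y s.
    move=> rE; have ps' : pawn_at (P k.+1) y (tr y k.+1) s' by apply: pr'; lia.
    have [_ /(_ tk0) s'f] := pawn_at_trail lg kL ps'.
    have s's : s' = s by apply: (@rel_rank_inj Y); rewrite // s'f sf.
    have lx : loc (tr (X, f, true) k.+1) = Some s'.
      by rewrite s's; apply: xs; lia.
    by have /esym := pawn_at_colour lg kL ps' lx; apply: opponent_neq.
  split=> [|s1 [l1 _]]; first by lia.
  move: l1; rewrite lE => -[<-]; lia.
by rewrite n12 leqnn.
Qed.

(** The rank bounds the number of moves that the pawn has made by the end of
phase 1, which are all its moves if it is captured in phase 2. If it survives
phase 2 it is never captured. *)
Lemma frozen_pawn f s : pawn_at (P n1) (X, f, true) (tr (X, f, true) n1) s ->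
  credit ms (X, f, true) L <= rel_rank X s \/
  (forall i, n1 <= i <= n2 -> loc (tr (X, f, true) i) = Some s) /\
  credit ms (X, f, true) L + takes (tr (X, f, true) L) <= 6.
Proof.
set x := (X, f, true) => px; have n1L : n1 <= L by lia.
have n12L : n1 <= n2 <= L by lia.
have n2LL : n2 <= L <= L by lia.
have [lt0 _] := pawn_at_trail lg n1L px.
have [l2|p2] := inactive_pawn (x := x) n12L phase2 px.
  left; rewrite /credit (lost_forever n2L l2) l2 /=.
  by have [-> _] := inactive_counts (x := x) n12L phase2; move: lt0 => /=; lia.
right; split=> [i /andP[n1i in2]|].
  have n1iL : n1 <= i <= L by lia.
  have ina : inactive X n1 i by move=> j jP; apply: phase2; lia.
  have [li|[]//] := inactive_pawn (x := x) n1iL ina px.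
  by have := lost_forever in2 li; case: p2 => + _ => /[swap] ->; rewrite li.
have live : loc (tr x L) <> None.
  by apply: (@survives x _ _ n2LL phase3); rewrite (proj1 p2).
have [le6 _] := tracked_after lg x (leqnn L).
by rewrite /credit; case: eqP => // _; rewrite addn0; move: le6 => /=; lia.
Qed.

Lemma waiting_pawn_credit f :
  credit ms (Y, f, true) L <= (quiet (tr (Y, f, true) n2)).+1.
Proof.
have n2LL : n2 <= L <= L by lia.
rewrite /credit; have [-> _] := inactive_counts (x := (Y, f, true)) n2LL phase3.
by rewrite -[(quiet _).+1]addn1 leq_add2l leq_b1.
Qed.

Lemma file_all_alive f : (forall g, alive g) ->
  credit ms (X, f, true) L + credit ms (Y, f, true) L <= 12.
Proof.
move=> al.
have [[s [px r5]]|[_ [g]]] := held_back (al f) (leqnn n1); last by rewrite al.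
have vx := pawn_credit lg X f; have vy := pawn_credit lg Y f.
have [|[stay v6]] := frozen_pawn px; first lia.
have [tk0|] := posnP (takes (tr (X, f, true) L)); last by lia.
have n1L : n1 <= L by lia.
have [/= lt0 file] := pawn_at_trail lg n1L px.
have sf : s.1 = f.
  by apply: file; have := takes_mono (X, f, true) n1L; lia.
have rs : 0 < rel_rank X s <= 5 by lia.
have vy' := waiting_pawn_credit f.
have [|tk] := blocked_file (al f) sf rs stay; first lia.
by have := takes_mono (Y, f, true) n2L; lia.
Qed.

Lemma file_alive f : alive f ->
  credit ms (X, f, true) L + credit ms (Y, f, true) L <= 13.
Proof.
move=> al; have n1L : n1 <= L by lia.
have vx := pawn_credit lg X f; have vy := pawn_credit lg Y f.
have [[s [px r5]]|[tk _]] := held_back al (leqnn n1).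
  by have [|[_ v6]] := frozen_pawn px; lia.
by have := takes_mono (X, f, true) n1L; lia.
Qed.

Lemma file_dead f : ~~ alive f ->
  credit ms (X, f, true) L + credit ms (Y, f, true) L <= 8.
Proof.
move=> /negPn/eqP dead; have n1L : n1 <= L by lia.
have vx := pawn_credit lg X f.
have [q0 _ _] := waiting_pawn f (leqnn n1).
rewrite {2}/credit (lost_forever n1L dead) q0 dead /=; lia.
Qed.

Lemma sum_color (F : color -> nat) c : \sum_d F d = F c + F (opponent c).
Proof.
rewrite (bigD1 c) //= (bigD1 (opponent c)) /=; last first.
  by rewrite eq_sym eq_opponent eqxx.
by rewrite big1 ?addn0 // => d; rewrite eq_opponent negbK => /andP[/negPf->].
Qed.

Lemma three_phase_bound : \sum_(j < L) critical_move ms j <= 115.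
Proof.
apply: leq_trans (critical_count lg (leqnn L)) _.
pose v f := credit ms (X, f, true) L + credit ms (Y, f, true) L.
have -> : \sum_x credit ms x L =
    \sum_f (v f + (credit ms (X, f, false) L + credit ms (Y, f, false) L)).
  transitivity (\sum_c \sum_f \sum_b credit ms (c, f, b) L).
    rewrite pair_bigA /= pair_bigA /=.
    by apply: eq_bigr => -[[c f] b] _.
  rewrite (sum_color _ X) -big_split /=; apply: eq_bigr => f _.
  by rewrite !big_bool /= /v; lia.
apply: (@leq_trans (\sum_f (v f + 2))).
  apply: leq_sum => f _; rewrite leq_add2l.
  exact: (leq_add (officer_credit lg X f) (officer_credit lg Y f)).
rewrite big_split /= sum_nat_const card_ord.
have [/forallP al|/forallPn[g dead]] := boolP [forall g, alive g].
  have : \sum_f v f <= \sum_(f : 'I_8) 12.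
    by apply: leq_sum => f _; apply: file_all_alive.
  rewrite sum_nat_const card_ord => le96.
  exact: leq_trans (leq_add le96 (leqnn _)) _.
rewrite (bigD1 g) //=.
have : \sum_(f | f != g) v f <= \sum_(f : 'I_8 | f != g) 13.
  apply: leq_sum => f _; have [/file_alive//|/file_dead] := boolP (alive f).
  by move/leq_trans; apply.
rewrite sum_nat_const cardC1 card_ord => le91.
exact: (leq_add (leq_add (file_dead dead) le91) (leqnn 16)).
Qed.
End Phases.

(** * Blocks and switches *)

Lemma blocks_head y s : exists r rs, blocks (y :: s) = (y :: r) :: rs.
Proof.
rewrite /=; case: (blocks s) => [|[|z r] rs]; [by exists [::], [::]| |].
  by exists [::], [::].
by case: eqP => [->|_]; [exists (z :: r), rs|exists [::], ((z :: r) :: rs)].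
Qed.

Lemma size_blocks_cons x y s :
  size (blocks (x :: y :: s)) = (x != y) + size (blocks (y :: s)).
Proof.
have [r [rs E]] := blocks_head y s.
by rewrite [blocks (x :: _)]/= -/(blocks (y :: s)) E; case: eqP.
Qed.

Lemma size_blocks_prefix s t : size (blocks s) <= size (blocks (s ++ t)).
Proof.
elim: s => [|x [|y s] IH] //; first by have [r [rs ->]] := blocks_head x t.
by rewrite !cat_cons !size_blocks_cons leq_add2l.
Qed.

Lemma sum_switches x0 x (s : seq color) :
  \sum_(1 <= i < (size s).+1) (nth x0 (x :: s) i != nth x0 (x :: s) i.-1)
  = (size (blocks (x :: s))).-1.
Proof.
elim: s x => [|y s IH] x; first by rewrite big_geq.
rewrite size_blocks_cons; have : 0 < size (blocks (y :: s)).
  by have [r [rs ->]] := blocks_head y s.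
have := IH y; set b := size (blocks (y :: s)) => IHy b0.
rewrite big_nat_recl //= eq_sym.
have -> : \sum_(1 <= i < (size s).+1)
    (nth x0 (y :: s) i != nth x0 (x :: y :: s) i) = b.-1.
  by rewrite -IHy; apply: eq_big_nat => -[].
by lia.
Qed.

Lemma switches_ge_blocks ms :
  (size (blocks (critical_colors ms))).-1 <= switch_count ms.
Proof.
rewrite /switch_count /num_segments /segment_ends.
set cs := critical_plies ms; set tl := if _ then _ else _.
have -> : size cs + has_tail ms = size (cs ++ tl).
  by rewrite size_cat /tl; case: (has_tail ms).
have -> : \sum_(1 <= i < (size (cs ++ tl)).+1)
      (ply_color (nth 0 (0 :: cs ++ tl) i)
         != ply_color (nth 0 (0 :: cs ++ tl) i.-1))
    = \sum_(1 <= i < (size (map ply_color (cs ++ tl))).+1)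
      (nth White (Black :: map ply_color (cs ++ tl)) i
         != nth White (Black :: map ply_color (cs ++ tl)) i.-1).
  rewrite size_map; apply: eq_big_nat => i /andP[i0 il].
  rewrite -[Black :: _]/(map ply_color (0 :: cs ++ tl)).
  by rewrite !(nth_map 0) //=; case: i i0 il => //= i _ /ltnW.
rewrite sum_switches map_cat.
have := size_blocks_prefix (map ply_color cs) (map ply_color tl).
have le s : size (blocks s) <= size (blocks (Black :: s)).
  by case: s => [|y s]; rewrite ?size_blocks_cons ?leq_addl.
rewrite /critical_colors -/cs => /leq_trans/(_ (le _)).
by case: (size _) => // n; case: (size _).
Qed.

(** Prepending the colour [x] lets the first block be empty, which makes the
induction uniform and lets the lemma be applied again to the rest with the
opposite colour. *)
Lemma split_first_colour (cs : seq nat) x k :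
  size (blocks (x :: map ply_color cs)) <= k.+2 ->
  exists c1 c2, [/\ cs = c1 ++ c2, all (fun i => ply_color i == x) c1
    & size (blocks (opponent x :: map ply_color c2)) <= k.+1].
Proof.
elim: cs => [|i cs IH] /=; first by exists [::], [::].
have [ix|ix] := eqVneq (ply_color i) x.
  rewrite ix size_blocks_cons eqxx add0n => /IH[c1 [c2 [-> a1 b2]]].
  by exists (i :: c1), c2; split=> //=; rewrite ix eqxx.
have -> : ply_color i = opponent x by apply/eqP; rewrite eq_opponent.
rewrite size_blocks_cons => b; exists [::], (i :: cs); split=> //=.
have ii : ply_color i = opponent x by apply/eqP; rewrite eq_opponent.
rewrite ii size_blocks_cons eqxx.
by move: b; rewrite eq_sym -eq_opponent eqxx.
Qed.

Lemma critical_plyE ms i :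
  i < size ms -> critical_ply ms i.+1 = critical_move ms i.
Proof.
by move=> lt; rewrite /critical_ply /= (drop_nth (Castle KingSide)).
Qed.

Lemma count_critical ms :
  size (critical_plies ms) = \sum_(j < size ms) critical_move ms j.
Proof.
rewrite -(big_mkord xpredT (fun j => critical_move ms j : nat)).
rewrite /index_iota subn0.
rewrite /critical_plies size_filter -sum1_count big_mkcond /=.
rewrite (iotaDl 1 0) big_map.
rewrite big_seq [RHS]big_seq; apply: eq_bigr => j.
rewrite mem_iota => /andP[_ lt].
by rewrite add1n critical_plyE //; case: (critical_move _ _).
Qed.

Lemma few_blocks_bound ms : legal_sequence initial_position ms ->
  size (blocks (critical_colors ms)) <= 3 -> size (critical_plies ms) <= 115.
Proof.
move=> lg; rewrite /critical_colors count_critical.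
have srt : sorted ltn (critical_plies ms).
  by apply: sorted_filter (iota_ltn_sorted _ _); apply: ltn_trans.
have mem j :
    j < size ms -> critical_move ms j -> j.+1 \in critical_plies ms.
  by move=> lt cm; rewrite mem_filter critical_plyE // cm mem_iota add1n ltnS.
have le i : i \in critical_plies ms -> i <= size ms.
  by rewrite mem_filter mem_iota add1n ltnS => /and3P[].
move: (critical_plies ms) srt mem le => cs srt mem le b3.
have [X bX] : exists X, size (blocks (X :: map ply_color cs)) <= 3.
  case: cs b3 {srt mem le} => [|i cs] b3; first by exists White.
  by exists (ply_color i); rewrite /= size_blocks_cons eqxx.
have [c1 [c' [E1 a1 bY]]] := split_first_colour bX.
have [c2 [c3 [E2 a2 b1]]] := split_first_colour bY.
have a3 : all (fun i => ply_color i == X) c3.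
  move: b1; rewrite opponentK; elim: c3 {E2} => //= i c IH.
  rewrite size_blocks_cons.
  have [r [rs E]] := blocks_head (ply_color i) (map ply_color c).
  by case: eqVneq => [<-|_]; rewrite ?add0n ?E //= eqxx => /IH.
subst c' cs.
(* The last plies of the first two parts; a part may be empty. *)
pose n1 := \max_(i <- c1) i; pose n2 := maxn n1 (\max_(i <- c2) i).
have := srt; rewrite (sorted_pairwise ltn_trans) !pairwise_cat.
case/and3P; rewrite allrel_catr => /andP[/allrelP lt12 /allrelP lt13] _.
case/and3P=> /allrelP lt23 _ _.
have max_lt c j : 0 < j -> {in c, forall i, i < j} -> \max_(i <- c) i < j.
  by case: j => // j _ H; apply/bigmax_leqP_seq => i ic _; apply: H.
have le_max (c : seq nat) i : i \in c -> i <= \max_(i <- c) i.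
  by move=> ic; apply: (@leq_bigmax_seq _ c xpredT id).
have phase k : k < size ms -> critical_move ms k ->
    if k < n1 then turn (position_after ms k) = X
    else if k < n2 then turn (position_after ms k) = opponent X
    else turn (position_after ms k) = X.
  move=> kL cm; rewrite turn_after ?(ltnW kL) //.
  have := mem _ kL cm; rewrite !mem_cat => /or3P[] kc.
  - by rewrite -[k < n1]/(k.+1 <= n1) le_max //; apply/eqP/(allP a1).
  - have -> : (k < n1) = false.
      apply/negbTE; rewrite -leqNgt -ltnS.
      by apply: max_lt => // i ic; apply: lt12.
    by rewrite leq_max le_max ?orbT //; apply/eqP/(allP a2).
  - have -> : (k < n1) = false.
      apply/negbTE; rewrite -leqNgt -ltnS.
      by apply: max_lt => // i ic; apply: lt13.
    have -> : (k < n2) = false.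
      apply/negbTE; rewrite -leqNgt geq_max; apply/andP; split.
        by rewrite -ltnS; apply: max_lt => // i ic; apply: lt13.
      by rewrite -ltnS; apply: max_lt => // i ic; apply: lt23.
    exact/eqP/(allP a3).
have n2L : n2 <= size ms.
  rewrite geq_max; apply/andP; split; apply/bigmax_leqP_seq => i ic _;
  by apply: le; rewrite !mem_cat ic ?orbT.
have n12 : n1 <= n2 by apply: leq_maxl.
apply: (three_phase_bound lg n12 n2L (X := X)) => k /andP[k1 k2] cm.
- have kL : k < size ms by lia.
  by have := phase k kL cm; rewrite k2 => ->; case: (X).
- have kL : k < size ms by lia.
  by have := phase k kL cm; rewrite ltnNge k1 k2 /= => ->; case: (X).
- have := phase k k2 cm; rewrite ltnNge (leq_trans n12 k1) ltnNge k1 /= => ->.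
  by case: (X).
Qed.

Theorem theorem4p7 (ms : seq move) (game_ms : game ms)
    (K118 : num_segments ms = 118) :
  4 <= size (blocks (critical_colors ms)) /\ 3 <= switch_count ms.
Proof.
have [lg _ _] := game_ms.
have b4 : 4 <= size (blocks (critical_colors ms)).
  rewrite ltnNge; apply/negP => /(few_blocks_bound lg).
  by move: K118; rewrite /num_segments; case: (has_tail ms); lia.
split=> //; apply: leq_trans (switches_ge_blocks ms).
by case: (size _) b4.
Qed.
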